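(* A near prequantale $Q$ is simple if and only if, for all $x,y,a\in Q$ with $a<\bigvee Q$, one has: $x\le y$ if and only if, for all $f\in\mathrm{Lin}(Q)$, $f(y)\le a$ implies $f(x)\le a$.
   Context: An ordered magma is a magma (not assumed associative, commutative or unital) with a partial order such that $x\le x'$ and $y\le y'$ imply $xy\le x'y'$. A near sup-magma is an ordered magma in which every nonempty subset has a supremum. A near prequantale is a near sup-magma $Q$ such that $a(\bigvee X)=\bigvee(aX)$ and $(\bigvee X)a=\bigvee(Xa)$ for all $a\in Q$ and all nonempty $X\subset Q$. A map $f$ between posets is near sup-preserving if $f(\bigvee X)=\bigvee f(X)$ for every nonempty subset $X$ whose supremum exists. A near sup-magma $M$ is simple if every nonconstant near sup-preserving magma homomorphism from $M$ to a near sup-magma is injective. For $r\in Q$, the translations $L_r,R_r:Q\to Q$ are $L_r(x)=rx$ and $R_r(x)=xr$; $\mathrm{Lin}(Q)$ is the submonoid (containing the identity map) generated by all translations of the monoid of all self-maps of $Q$ under composition. *)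

(* Defs.v *)
From HB Require Import structures.
From mathcomp Require Import all_boot all_order all_classical.
Set Implicit Arguments.
Unset Strict Implicit.
Unset Printing Implicit Defensive.

Local Open Scope classical_set_scope.
Local Open Scope group_scope.
Local Open Scope order_scope.

HB.mixin Record isOrderedMagma (d : Order.disp_t) T
    of Order.POrder d T & Magma T := {
  le_mulg : forall x x' y y' : T, x <= x' -> y <= y' -> x * y <= x' * y'
}.

#[short(type="orderedMagmaType")]
HB.structure Definition OrderedMagma (d : Order.disp_t) :=
  { T of Order.POrder d T & Magma T & isOrderedMagma d T }.

(* [supremums X s] says that s is the least upper bound of X. *)
HB.mixin Record isNearSupMagma (d : Order.disp_t) T of OrderedMagma d T := {
  supremums_neq0 : forall X : set T, X !=set0 -> supremums X !=set0
}.

#[short(type="nearSupMagmaType")]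
HB.structure Definition NearSupMagma (d : Order.disp_t) :=
  { T of OrderedMagma d T & isNearSupMagma d T }.

(* Suprema exist in T and are unique, so these are the equations
   a (sup X) = sup (a X) and (sup X) a = sup (X a) for nonempty X. *)
HB.mixin Record isNearPrequantale (d : Order.disp_t) T
    of NearSupMagma d T := {
  supremums_mulgl : forall (a : T) (X : set T) (s : T), X !=set0 ->
    supremums X s -> supremums [set a * x | x in X] (a * s);
  supremums_mulgr : forall (a : T) (X : set T) (s : T), X !=set0 ->
    supremums X s -> supremums [set x * a | x in X] (s * a)
}.

#[short(type="nearPrequantaleType")]
HB.structure Definition NearPrequantale (d : Order.disp_t) :=
  { T of NearSupMagma d T & isNearPrequantale d T }.

Definition near_sup_preserving (d d' : Order.disp_t)
    (P : porderType d) (P' : porderType d') (f : P -> P') : Prop :=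
  forall (X : set P) (s : P), X !=set0 ->
    supremums X s -> supremums (f @` X) (f s).

Definition constant_map (A B : Type) (f : A -> B) : Prop :=
  forall x y : A, f x = f y.

Definition simple_near_sup_magma (d : Order.disp_t) (M : nearSupMagmaType d)
    : Prop :=
  forall (d' : Order.disp_t) (N : nearSupMagmaType d')
         (f : {multiplicative M -> N}),
    near_sup_preserving f -> ~ constant_map f -> injective f.

Definition left_translation (T : magmaType) (r : T) : T -> T := fun x => r * x.
Definition right_translation (T : magmaType) (r : T) : T -> T := fun x => x * r.

Definition translations (T : magmaType) : set (T -> T) :=
  range (@left_translation T) `|` range (@right_translation T).
Arguments translations : clear implicits.

Definition submonoid_of_maps (T : Type) (S : set (T -> T)) : Prop :=
  S idfun /\ forall f g, S f -> S g -> S (f \o g).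

Definition Lin (T : magmaType) : set (T -> T) :=
  smallest (@submonoid_of_maps T) (translations T).
Arguments Lin : clear implicits.

(* Main.v *)
Require Import Defs.
From HB Require Import structures.
From mathcomp Require Import all_boot all_order all_classical.

Local Open Scope order_scope.

(** For a in Q, let x |-> r(x) be the largest z such that f(x) <= a implies
    f(z) <= a for all f in Lin(Q). Elements of Lin(Q) preserve nonempty suprema,
    so r is a closure operator with r(x) r(y) <= r(xy), and its fixed points form
    a near sup-magma that receives Q by a near sup-preserving homomorphism. Since
    r(a) = a, this map is nonconstant when a is not the top; if Q is simple it is
    injective, so r is the identity, which is the stated condition.
    Conversely, let f be a nonconstant near sup-preserving homomorphism, choose w
    with f(w) < f(top), and let a be the largest z with f(z) <= f(w). The kernel
    of f is stable under Lin(Q), so f(x) = f(y) gives g(x) <= a iff g(y) <= a for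
    all g in Lin(Q), and the condition for this a yields x = y. *)

Import Order.POrderTheory.
Local Open Scope classical_set_scope.

Section Suprema.
Context {d : Order.disp_t}.

Lemma supremums_supremum {Q : nearSupMagmaType d} (x0 : Q) (X : set Q) :
  X !=set0 -> supremums X (supremum x0 X).
Proof.
move=> X0; rewrite /supremum ifF; last exact/negbTE/set0P.
by case: xgetP => [s -> //|noX]; have [s /noX] := supremums_neq0 X X0.
Qed.

(** If [x <= y], then [y] is the supremum of the pair [[set x; y]], so [f y] bounds [f x]. *)
Lemma near_sup_preserving_homo {d' : Order.disp_t} {P : porderType d}
    {P' : porderType d'} {f : P -> P'} :
  near_sup_preserving f -> {homo f : x y / x <= y}.
Proof.
move=> fS x y xy; have xyS : supremums [set x; y] y.
  split=> [z [->|->] //|b]; apply; exact: or_intror.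
have [fyub _] := fS _ _ (ex_intro _ x (or_introl erefl)) xyS.
by apply: fyub; exists x => //; left.
Qed.

End Suprema.

Section LinTheory.
Context {T : magmaType}.

Lemma Lin_idfun : Lin T idfun.
Proof. by move=> S [[]]. Qed.

Lemma Lin_comp (f g : T -> T) : Lin T f -> Lin T g -> Lin T (f \o g).
Proof.
by move=> Lf Lg S SP; apply: SP.1.2; [exact: Lf|exact: Lg].
Qed.

Lemma Lin_left (r : T) : Lin T (left_translation r).
Proof. by apply: sub_gen_smallest; left; exists r. Qed.

Lemma Lin_right (r : T) : Lin T (right_translation r).
Proof. by apply: sub_gen_smallest; right; exists r. Qed.

(** The maps that respect the kernel of [f] form a submonoid containing all translations, hence all
    of [Lin T]. *)
Lemma Lin_congr {N : magmaType} (f : {multiplicative T -> N}) (g : T -> T)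
    (x y : T) : Lin T g -> f x = f y -> f (g x) = f (g y).
Proof.
move=> Lg; pose S := [set g | forall x y, f x = f y -> f (g x) = f (g y)].
suff: S g by apply.
apply: smallest_sub Lg => [|h [[r _ <-]|[r _ <-]] u v fuv].
- by split=> // h k Sh Sk u v /Sk /Sh.
- by rewrite /left_translation !gmulfM fuv.
- by rewrite /right_translation !gmulfM fuv.
Qed.

End LinTheory.

Lemma Lin_near_sup_preserving {d : Order.disp_t} {Q : nearPrequantaleType d}
    (f : Q -> Q) : Lin Q f -> near_sup_preserving f.
Proof.
move=> Lf; apply: (smallest_sub _ _ Lf (X := @near_sup_preserving d d Q Q)).
  split=> [X s _|g h gS hS X s X0 Xs]; first by rewrite image_id.
  rewrite -image_comp; apply: gS; last exact: hS.
  by case: X0 => x Xx; exists (h x), x.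
by move=> g [] [r _ <-] X s X0; [apply: supremums_mulgl|apply: supremums_mulgr].
Qed.

Section LinClosure.
Context {d : Order.disp_t} {Q : nearPrequantaleType d} (a : Q).

(** The syntactic preorder of the down-set of [a], with the larger element as first argument. *)
Definition lin_le (x z : Q) := forall f, Lin Q f -> f x <= a -> f z <= a.

Definition lin_closure (x : Q) : Q := supremum x [set z | lin_le x z].

Lemma le_lin_le (x z : Q) : z <= x -> lin_le x z.
Proof.
move=> zx f /Lin_near_sup_preserving/near_sup_preserving_homo fH.
exact: le_trans (fH _ _ zx).
Qed.

Lemma lin_closure_supremums (x : Q) :
  supremums [set z | lin_le x z] (lin_closure x).
Proof. by apply: supremums_supremum; exists x; exact: le_lin_le. Qed.

Lemma lin_le_closure (x : Q) : lin_le x (lin_closure x).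
Proof.
move=> f Lf fxa; have X0 : [set z | lin_le x z] !=set0.
  by exists x; exact: le_lin_le.
have [_] := Lin_near_sup_preserving f Lf _ _ X0 (lin_closure_supremums x).
by apply=> _ [z xz <-]; exact: xz.
Qed.

Lemma le_lin_closure (x z : Q) : z <= lin_closure x <-> lin_le x z.
Proof.
split=> [zx f Lf fxa|xz]; last by apply: (lin_closure_supremums x).1.
by apply: (le_lin_le _ _ zx) => //; exact: lin_le_closure.
Qed.

Lemma lin_closure_ge (x : Q) : x <= lin_closure x.
Proof. exact/le_lin_closure/le_lin_le. Qed.

Lemma lin_le_trans (x y z : Q) : lin_le x y -> lin_le y z -> lin_le x z.
Proof. by move=> xy yz f Lf fx; apply: (yz) => //; exact: xy. Qed.

Lemma lin_closure_mono (x z : Q) :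
  lin_le x z -> lin_closure z <= lin_closure x.
Proof.
move=> xz; apply/le_lin_closure; apply: lin_le_trans xz _.
exact: lin_le_closure.
Qed.

Lemma lin_closure_idem (x : Q) : lin_closure (lin_closure x) = lin_closure x.
Proof.
by apply/le_anti/andP; split;
  [apply/lin_closure_mono/lin_le_closure|exact: lin_closure_ge].
Qed.

Lemma lin_closure_id : lin_closure a = a.
Proof.
apply/le_anti; rewrite lin_closure_ge andbT.
exact: (lin_le_closure a _ Lin_idfun).
Qed.

(** One factor is replaced at a time, from [x * y] to [x' * y] to [x' * y']; the fixed factor is
    absorbed into [f] as a translation. *)
Lemma lin_le_mul (x x' y y' : Q) :
  lin_le x x' -> lin_le y y' -> lin_le (x * y)%g (x' * y')%g.
Proof.
move=> xx' yy' f Lf fxy; apply: (yy' _ (Lin_comp _ _ Lf (Lin_left x'))).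
exact: (xx' _ (Lin_comp _ _ Lf (Lin_right y))).
Qed.

Definition lin_closed := {x : Q | lin_closure x == x}.

HB.instance Definition _ := SubType.on lin_closed.
HB.instance Definition _ := Choice.on lin_closed.
HB.instance Definition _ := [SubChoice_isSubPOrder of lin_closed by <: with d].

Definition to_lin_closed (x : Q) : lin_closed :=
  exist _ (lin_closure x) (introT eqP (lin_closure_idem x)).

Lemma lin_closedP (x : lin_closed) : lin_closure (val x) = val x.
Proof. exact/eqP/(valP x). Qed.

(** A product of closed elements need not be closed, so it is closed again. *)
HB.instance Definition _ := hasMul.Build lin_closed
  (fun x y => to_lin_closed (val x * val y)%g).

(** Closure is left adjoint to the inclusion of closed elements; this is why it preserves
    suprema. *)
Lemma to_lin_closed_le (x : Q) (y : lin_closed) :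
  (to_lin_closed x <= y) = (x <= val y).
Proof.
rewrite -Order.le_val /=; apply/idP/idP => [|xy].
  by apply: le_trans; exact: lin_closure_ge.
by rewrite -(lin_closedP y); exact/lin_closure_mono/le_lin_le.
Qed.

Lemma lin_closed_le_mulg (x x' y y' : lin_closed) :
  x <= x' -> y <= y' -> (x * y <= x' * y')%g.
Proof.
rewrite -!Order.le_val => xx' yy'.
exact/lin_closure_mono/le_lin_le/le_mulg.
Qed.

HB.instance Definition _ := isOrderedMagma.Build d lin_closed lin_closed_le_mulg.

Lemma to_lin_closed_near_sup_preserving : near_sup_preserving to_lin_closed.
Proof.
move=> X s _ [Xs sX]; split=> [_ [x Xx <-]|b bX].
  by rewrite to_lin_closed_le /= (le_trans (Xs x Xx)) ?lin_closure_ge.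
rewrite to_lin_closed_le; apply: sX => x Xx.
by rewrite -to_lin_closed_le; apply: bX; exists x.
Qed.

Lemma val_to_lin_closed (x : lin_closed) : to_lin_closed (val x) = x.
Proof. exact/val_inj/lin_closedP. Qed.

Lemma lin_closed_supremums_neq0 (X : set lin_closed) :
  X !=set0 -> supremums X !=set0.
Proof.
move=> [x Xx]; have X0 : val @` X !=set0 by exists (val x), x.
(* The supremum among closed elements is the closure of the supremum taken in [Q]. *)
have [s Xs] := supremums_neq0 _ X0; exists (to_lin_closed s).
have := to_lin_closed_near_sup_preserving _ _ X0 Xs.
by rewrite image_comp (eq_imagel (fun y _ => val_to_lin_closed y)) image_id.
Qed.

HB.instance Definition _ :=
  isNearSupMagma.Build d lin_closed lin_closed_supremums_neq0.

Lemma to_lin_closedM : {morph to_lin_closed : x y / (x * y)%g}.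
Proof.
move=> x y; apply/val_inj/le_anti/andP; split=> /=; apply: lin_closure_mono.
  by apply: lin_le_mul; apply/le_lin_le/lin_closure_ge.
by apply: lin_le_mul; exact: lin_le_closure.
Qed.

HB.instance Definition _ :=
  isMultiplicative.Build Q lin_closed to_lin_closed to_lin_closedM.

End LinClosure.

Lemma simple_lin_le {d : Order.disp_t} {Q : nearPrequantaleType d}
    (a x y : Q) :
  simple_near_sup_magma Q -> a < supremum a [set: Q] -> lin_le a y x -> x <= y.
Proof.
move=> simpleQ aT yx; suff /(_ y) <- : forall z, lin_closure a z = z.
  exact/le_lin_closure.
have inj : injective (to_lin_closed a).
  apply: simpleQ; first exact: to_lin_closed_near_sup_preserving.
  (* A constant map would give [a], which is closed, and the top the same closure, putting the top
     below [a]. *)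
  move=> /(_ a (supremum a setT))/(congr1 val) /= aTE.
  have := lin_closure_ge a (supremum a setT).
  by rewrite -aTE lin_closure_id lt_geF.
by move=> z; apply/inj/val_inj/lin_closure_idem.
Qed.

Lemma exists_separating {d d' : Order.disp_t} {Q : nearPrequantaleType d}
    {N : nearSupMagmaType d'} {f : Q -> N} :
  near_sup_preserving f -> ~ constant_map f ->
  exists a w, a < supremum a [set: Q] /\ forall z, (z <= a) = (f z <= f w).
Proof.
move=> fS fNcst; have fH := near_sup_preserving_homo fS.
have [x [y /eqP fxy]] : exists x y, f x <> f y.
  by apply: contrapT => no; apply: fNcst => x y; apply: contrapT => fxy;
    apply: no; exists x, y.
have leT z b : b <= supremum z [set: Q].
  by apply: (supremums_supremum z setT (ex_intro _ z I)).1.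
(* Of two elements with distinct images, at least one misses the image of the top. *)
have [w fwT] : exists w, f w < f (supremum x setT).
  have [fxT|] := eqVneq (f x) (f (supremum x setT)).
    by exists y; rewrite lt_neqAle fH ?leT // -fxT eq_sym fxy.
  by exists x; rewrite lt_neqAle fH ?leT // andbT.
pose X := [set z | f z <= f w]; pose a := supremum w X.
have X0 : X !=set0 by exists w; exact: lexx.
have Xa : supremums X a by exact: supremums_supremum.
(* Preservation of suprema puts [a] itself in [X], so [X] is exactly the down-set of [a]. *)
have faw : f a <= f w by have [_] := fS _ _ X0 Xa; apply=> _ [z ? <-].
exists a, w; split; last first.
  by move=> z; apply/idP/idP => [/fH/le_trans -> //|]; exact: Xa.1.
rewrite lt_neqAle leT andbT; apply: contraTneq faw => ->.
by rewrite lt_geF // (lt_le_trans fwT) ?fH ?leT.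
Qed.

(* [supremum a A] defaults to a only when A has no supremum; here Q is nonempty,
   as it contains a, so [set: Q] has one. *)
Theorem corollary8p9 (d : Order.disp_t) (Q : nearPrequantaleType d) :
  simple_near_sup_magma Q <->
  (forall x y a : Q, a < supremum a [set: Q]%classic ->
     (x <= y <-> (forall f : Q -> Q, Lin Q f -> f y <= a -> f x <= a))).
Proof.
split=> [simpleQ x y a aT|sepQ d' N f fS fNcst].
  by split; [exact: le_lin_le|exact: simple_lin_le].
have [a [w [aT leaE]]] := exists_separating fS fNcst.
suff inj x y : f x = f y -> x <= y.
  by move=> x y fxy; apply/le_anti; rewrite !inj.
move=> fxy; apply/(sepQ _ _ _ aT) => g Lg.
by rewrite !leaE (Lin_congr f g _ _ Lg fxy).
Qed.
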